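(* Let $H$ be a connected graph with $n_0$ vertices, $m_0$ edges, and $\delta(H)\geq 2$. Then \[ ecvc(S(H))=cvc(S(H))=2n_0-1. \] Moreover, every minimum connected vertex cover of $S(H)$ is an eternally winning configuration.
   Context: All graphs are finite and simple; $\delta(H)$ is the minimum degree. The full subdivision $S(H)$ of $H$ is obtained by replacing every edge $e=ab$ of $H$ by the path $a\,s_e\,b$, where $s_e$ is a new vertex (every edge is subdivided exactly once). A vertex cover of a graph $G$ is a set of vertices meeting every edge; a connected vertex cover is a vertex cover that induces a connected subgraph. $cvc(G)$ is the minimum size of a connected vertex cover of $G$, and a minimum connected vertex cover is one of size $cvc(G)$. Eternal Connected Vertex Cover game with $k$ guards on a connected graph $G$ with at least one edge: the defender first chooses a set of $k$ vertices and places one guard on each; this set must be a connected vertex cover. In each round the attacker attacks an edge. The defender responds by moving guards simultaneously: each guard stays put or moves to a neighbouring vertex, at least one guard must move across the attacked edge (from one endpoint to the other; guards on both endpoints may exchange positions), and after the movement at most one guard occupies each vertex. The set of occupied vertices must be a connected vertex cover after every response; otherwise (or if no legal response exists) the attacker wins. $ecvc(G)$ is the least $k$ such that the defender with $k$ guards can defend every infinite sequence of attacks. A set $S$ of vertices is an eternally winning configuration if, starting with one guard on each vertex of $S$ (so $|S|$ guards), the defender can defend every infinite sequence of attacks. *)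

(* Defs.v *)
From mathcomp Require Import all_boot all_fingroup.
From mathcomp Require Import boolp.

Set Implicit Arguments.
Unset Strict Implicit.
Unset Printing Implicit Defensive.

Record sgraph := SGraph {
  vertex :> finType;
  adj : rel vertex;
  adj_sym : symmetric adj;
  adj_irrefl : irreflexive adj
}.

Definition degree (G : sgraph) (x : G) : nat := #|[set y | adj x y]|.

(* A degree is at most #|G|, so the neutral element #|G| is harmless. *)
Definition min_degree (G : sgraph) : nat := \big[minn/#|G|]_(x : G) degree x.

Definition edge_set (G : sgraph) : {set {set G}} :=
  [set A | [exists x : G, exists y : G, adj x y && (A == [set x; y])]].

Notation edge G := {A : {set vertex G} | A \in edge_set G}.

(* The subgraph induced by S is connected; it is required to be nonempty. *)
Definition connected_in (G : sgraph) (S : {set G}) : bool :=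
  (S != set0) &&
  [forall x in S, forall y in S, connect [rel u v in S | adj u v] x y].

Definition connected_graph (G : sgraph) : bool := connected_in [set: G].

Section Subdivision.
Variable H : sgraph.

Definition subdiv_adj : rel (vertex H + edge H) := fun u v =>
  match u, v with
  | inl a, inr e | inr e, inl a => a \in val e
  | _, _ => false
  end.

Lemma subdiv_adj_sym : symmetric subdiv_adj.
Proof. by case=> [a|e] [b|f]. Qed.

Lemma subdiv_adj_irrefl : irreflexive subdiv_adj.
Proof. by case. Qed.

Definition subdivision : sgraph := SGraph subdiv_adj_sym subdiv_adj_irrefl.

End Subdivision.

Definition vertex_cover (G : sgraph) (S : {set G}) : bool :=
  [forall A in edge_set G, A :&: S != set0].

Definition connected_vertex_cover (G : sgraph) (S : {set G}) : bool :=
  vertex_cover S && connected_in S.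

(* When G is connected, [set: G] is a connected vertex cover, so that the
   default value #|G| plays no role; see cvc_min and cvc_le below. *)
Definition cvc (G : sgraph) : nat :=
  \big[minn/#|G|]_(S : {set G} | connected_vertex_cover S) #|S|.

Definition min_connected_vertex_cover (G : sgraph) (S : {set G}) : Prop :=
  connected_vertex_cover S /\ #|S| = cvc G.

(* The guard standing on x \in S goes to f x; the values of f outside S are
   irrelevant. *)
Definition legal_response (G : sgraph) (S : {set G}) (A : edge G)
    (f : G -> G) : Prop :=
  [/\ forall x, x \in S -> f x = x \/ adj x (f x),
      {in S &, injective f},
      exists2 x, x \in S & val A = [set x; f x]
    & connected_vertex_cover (f @: S)].

(* A strategy maps the attacks made so far, the last one being the one to be
   answered, to the movement of the guards: it does not see future attacks. *)
Definition strategy (G : sgraph) : Type := seq (edge G) -> G -> G.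

Fixpoint play (G : sgraph) (sigma : strategy G) (S : {set G})
    (a : nat -> edge G) (n : nat) : {set G} :=
  if n is n'.+1 then sigma (mkseq a n) @: play sigma S a n' else S.

Definition eternally_winning (G : sgraph) (S : {set G}) : Prop :=
  connected_vertex_cover S /\
  exists sigma : strategy G, forall (a : nat -> edge G) (n : nat),
    legal_response (play sigma S a n) (a n) (sigma (mkseq a n.+1)).

Definition defendable (G : sgraph) (k : nat) : Prop :=
  exists S : {set G}, #|S| = k /\ eternally_winning S.

(* When G is connected, [set: G] is eternally winning, so that the default
   value #|G| plays no role; see ecvc_min and ecvc_le below. *)
Definition ecvc (G : sgraph) : nat :=
  \big[minn/#|G|]_(k < #|G|.+1 | `[< defendable G k >]) k.

Section Sanity.

Lemma bigminn_le (I : finType) (P : pred I) (F : I -> nat) d i :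
  P i -> \big[minn/d]_(j | P j) F j <= F i.
Proof.
move=> Pi; have := mem_index_enum i.
elim: (index_enum I) => //= j s IHs; rewrite inE big_cons => /predU1P[<-|/IHs le_i].
  by rewrite Pi geq_minl.
by case: ifP => // _; apply: leq_trans le_i; apply: geq_minr.
Qed.

Lemma bigminn_ex (I : finType) (P : pred I) (F : I -> nat) d :
  (exists2 i, P i & F i = d) -> exists2 i, P i & F i = \big[minn/d]_(j | P j) F j.
Proof.
move=> exd; apply: (big_ind (fun m => exists2 i, P i & F i = m)) => //.
  by move=> m n exm exn; rewrite /minn; case: ifP.
by move=> i Pi; exists i.
Qed.

Variable G : sgraph.

Lemma cvc_le (S : {set G}) : connected_vertex_cover S -> cvc G <= #|S|.
Proof. exact: bigminn_le. Qed.

Lemma defendable_ub k : defendable G k -> k <= #|G|.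
Proof. by move=> [S [<- _]]; apply: max_card. Qed.

Lemma ecvc_le k : defendable G k -> ecvc G <= k.
Proof.
move=> dk; have kG : k < #|G|.+1 by rewrite ltnS defendable_ub.
by apply: (@bigminn_le _ _ (@nat_of_ord _) _ (Ordinal kG)); apply/asboolP.
Qed.

Hypothesis conG : connected_graph G.

Lemma setT_connected_vertex_cover : connected_vertex_cover [set: G].
Proof.
rewrite /connected_vertex_cover -/(connected_graph G) conG andbT.
apply/forall_inP => A; rewrite inE setIT => /existsP[x /existsP[y /andP[_ /eqP->]]].
by apply/set0Pn; exists x; rewrite !inE eqxx.
Qed.

Lemma cvc_min :
  exists2 S : {set G}, connected_vertex_cover S & #|S| = cvc G.
Proof.
apply: bigminn_ex; exists [set: G]; last exact: cardsT.
exact: setT_connected_vertex_cover.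
Qed.

Lemma setT_eternally_winning : eternally_winning [set: G].
Proof.
split; first exact: setT_connected_vertex_cover.
have [z _] : exists z, z \in [set: G] by apply/set0Pn; case/andP: conG.
have swapP (A : edge G) : exists p : G * G,
    adj p.1 p.2 /\ val A = [set p.1; p.2].
  case: A => A /= ; rewrite inE => /existsP[x /existsP[y /andP[xy /eqP->]]].
  by exists (x, y).
have [h hP] := choice swapP.
pose sw (A : edge G) : {perm G} := tperm (h A).1 (h A).2.
pose sigma : strategy G := fun s => if rev s is A :: _ then sw A else id.
exists sigma => a n.
have sigE m : sigma (mkseq a m.+1) = sw (a m) by rewrite /sigma mkseqS rev_rcons.
have imT (p : {perm G}) : p @: [set: G] = [set: G].
  by apply/setP => x; rewrite inE; apply/imsetP; exists ((p^-1)%g x); rewrite ?inE ?permKV.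
have -> : play sigma [set: G] a n = [set: G].
  by elim: n => //= n IHn; rewrite sigE IHn imT.
have [adjh valh] := hP (a n).
rewrite sigE; split.
- move=> x _; rewrite /sw; case: tpermP => [->|->|]; by [left | right | right; rewrite adj_sym].
- by move=> x y _ _; apply: perm_inj.
- by exists (h (a n)).1; rewrite ?inE // /sw tpermL.
- by rewrite imT; apply: setT_connected_vertex_cover.
Qed.

Lemma ecvc_min : defendable G (ecvc G).
Proof.
have [|k /asboolP dk kE] := @bigminn_ex _
  (fun k : 'I_#|G|.+1 => `[< defendable G k >]) (@nat_of_ord _) #|G|.
  exists ord_max => //; apply/asboolP; exists [set: G].
  by split; [apply: cardsT | apply: setT_eternally_winning].
by rewrite /ecvc -kE.
Qed.

End Sanity.

(* Main.v *)
Require Import Defs.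
From mathcomp Require Import all_boot perm.
From mathcomp Require Import boolp.

(** The whole theorem rests on one fact: in [S(H)] every connected vertex
cover, minimum or not, can answer every attack by moving at most two guards and
is then again a connected vertex cover.  Hence every connected vertex cover is
eternally winning, which gives both the equality of [ecvc] and [cvc] and the
last claim.

Let [S] be a connected vertex cover and let the edge joining the old vertex [a]
to the subdivision vertex [e] be attacked, where [e = ab] in [H].
- If both ends carry a guard, these two guards exchange positions.
- If only [e] does, its guard moves to [a] ([sub_guard_slide]).  As [a] is
  empty, all subdivision vertices next to [a] are occupied, and there is one
  besides [e] because degrees are at least 2; so [e] was a leaf of the guarded
  subgraph, hanging on [b], and [a] is again attached to that subgraph.
- If only [a] does, its guard moves to [e] and has to be replaced
  ([old_guard_push]).  A simple path of guarded vertices from [a] to [b] starts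
  with a subdivision vertex [g] next to [a]; the guard of [g] moves to [a].
  The vertex [e] closes this path to a cycle, so losing [g] does not disconnect.

For the value [2 n0 - 1], sliding as in the second case fills the old vertices
one at a time without changing the number of guards, so some minimum connected
vertex cover contains all old vertices ([cover_with_old_vertices]).  Inside it
a spanning tree of [H] can be grown, which with its subdivision vertices is a
connected vertex cover of size exactly [n0 + (n0 - 1)]
([subdivision_spanning_tree]); by minimality it has the same size. *)

Set Implicit Arguments.
Unset Strict Implicit.
Unset Printing Implicit Defensive.

(** * Connectivity of induced subgraphs *)

Definition within (G : sgraph) (S : {set G}) : rel G :=
  [rel u v in S | adj u v].

Lemma within_connect_sym (G : sgraph) (S : {set G}) :
  connect_sym (within S).
Proof.
by apply: sym_connect_sym => x y; rewrite /within /= adj_sym (andbC (x \in S)).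
Qed.

Lemma connect_within (G : sgraph) (S : {set G}) (x y : G) :
  x \in S -> y \in S -> adj x y -> connect (within S) x y.
Proof. by move=> xS yS xy; apply: connect1; rewrite /within /= xS yS. Qed.

Lemma connected_inP (G : sgraph) (S : {set G}) (x y : G) :
  connected_in S -> x \in S -> y \in S -> connect (within S) x y.
Proof. by case/andP=> _ /forall_inP cS xS yS; move/forall_inP: (cS x xS); apply. Qed.

(** Connectivity is carried from [S] to [T] by a map that need not be a graph
morphism: adjacent vertices only have to be sent into one component.  Moving a
guard is such a map, where a vertex that is vacated is sent to a remaining
vertex that takes over its connections. *)
Lemma connected_in_transfer (G K : sgraph) (S : {set G}) (T : {set K})
    (r : G -> K) :
    connected_in S -> {in S, forall x, r x \in T} ->
    {in S &, forall x y, adj x y -> connect (within T) (r x) (r y)} ->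
    {in T, forall z, exists2 x, x \in S & connect (within T) z (r x)} ->
  connected_in T.
Proof.
move=> cS rT rS rsurj; apply/andP; split.
  have /set0Pn[x xS] : S != set0 by case/andP: cS.
  by apply/set0Pn; exists (r x); apply: rT.
have r_connect x y : x \in S -> y \in S -> connect (within T) (r x) (r y).
  move=> xS yS; have /connectP[p] := connected_inP cS xS yS.
  elim: p x xS => [|z p IHp] x xS /=; first by move=> _ ->; apply: connect0.
  case/andP=> /andP[/andP[_ zS] xz] pz ylast.
  by apply: connect_trans (IHp z zS pz ylast); apply: rS.
apply/forall_inP => z /rsurj[x xS zx]; apply/forall_inP => t /rsurj[y yS ty].
apply: (connect_trans zx); apply: (connect_trans (r_connect x y xS yS)).
by have := ty; rewrite within_connect_sym.
Qed.

Lemma connected_in_crossing (G : sgraph) (S D : {set G}) (x y : G) :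
    connected_in S -> x \in S -> x \in D -> y \in S -> y \notin D ->
  exists u v, [/\ u \in S, u \in D, v \in S, v \notin D & adj u v].
Proof.
move=> cS xS xD yS yD; have /connectP[p] := connected_inP cS xS yS.
elim: p x xS xD => [|z p IHp] x xS xD /=.
  by move=> _ yx; rewrite yx xD in yD.
case/andP=> /andP[/andP[_ zS] xz] pz ylast.
have [zD|zD] := boolP (z \in D); first exact: IHp zS zD pz ylast.
by exists x, z.
Qed.

(** * Answering one attack at a time *)

(** If no connected vertex cover is ever lost, the defender needs no memory
beyond the present positions of the guards.  A strategy sees only the attacks,
so it recomputes these positions by replaying its own earlier answers. *)
Lemma eternally_winning_of_responses (G : sgraph) :
    (forall (S : {set G}) (A : edge G), connected_vertex_cover S ->
       exists f, legal_response S A f) ->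
  forall S : {set G}, connected_vertex_cover S -> eternally_winning S.
Proof.
move=> respond S0 cvc0; split=> //.
have respond' (q : {set G} * edge G) : exists f : G -> G,
    connected_vertex_cover q.1 -> legal_response q.1 q.2 f.
  case: q => S A /=.
  have [/(respond S A)[f fP]|ncvc] := boolP (connected_vertex_cover S).
    by exists f.
  by exists id.
have [h hP] := choice respond'.
pose conf := foldl (fun S A => h (S, A) @: S) S0.
pose sigma : strategy G := fun s =>
  if rev s is A :: t then h (conf (rev t), A) else id.
have sigmaE a n : sigma (mkseq a n.+1) = h (conf (mkseq a n), a n).
  by rewrite /sigma mkseqS rev_rcons revK.
have playE a n : play sigma S0 a n = conf (mkseq a n).
  elim: n => [//|n IHn]; rewrite mkseqS /conf foldl_rcons -/conf.
  by rewrite -sigmaE -IHn.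
exists sigma => a n; rewrite playE sigmaE; apply: (hP (_, _)) => /=.
elim: n => [//|n IHn]; rewrite mkseqS /conf foldl_rcons.
by have [] := hP (_, a n) IHn.
Qed.

(** * Edges of a graph and of its subdivision *)

Lemma edge_ends (H : sgraph) (e : edge H) (a : H) :
  a \in val e -> exists2 b, adj a b & val e = [set a; b].
Proof.
case: e => A /= ; rewrite inE => /existsP[x /existsP[y /andP[xy /eqP->]]].
rewrite !inE => /orP[] /eqP->; first by exists y.
by exists x; rewrite ?[adj y x]adj_sym // setUC.
Qed.

Lemma edge_of_adj (H : sgraph) (a b : H) :
  adj a b -> exists e : edge H, val e = [set a; b].
Proof.
move=> ab; have eH : [set a; b] \in edge_set H.
  by rewrite inE; apply/existsP; exists a; apply/existsP; exists b; rewrite ab /=.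
by exists (Sub [set a; b] eH).
Qed.

Lemma other_edge (H : sgraph) (e : edge H) (a : H) :
  2 <= min_degree H -> exists2 f : edge H, f != e & a \in val f.
Proof.
move=> degH; have : 1 < degree a by apply: leq_trans degH _; apply: bigminn_le.
case/card_gt1P=> b [c [+ + bc]]; rewrite !inE => ab ac.
have [f fE] := edge_of_adj ab; have [g gE] := edge_of_adj ac.
have [fe|nfe] := eqVneq f e; last by exists f; rewrite // fE !inE eqxx.
exists g; last by rewrite gE !inE eqxx.
apply: contraNneq bc => ge; have : b \in val g by rewrite ge -fe fE !inE eqxx orbT.
rewrite gE !inE => /orP[/eqP ba|//].
by rewrite ba adj_irrefl in ab.
Qed.

Section Subdivision.
Variable H : sgraph.
Local Notation SH := (subdivision H).
Implicit Types (S C : {set SH}) (a b : H) (e f g : edge H).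

Local Notation old a := (inl a : SH).
Local Notation sub e := (inr e : SH).

Lemma subdivision_edge_ends (A : edge SH) :
  exists a e, a \in val e /\ val A = [set old a; sub e].
Proof.
case: A => A /= ; rewrite inE => /existsP[x /existsP[y /andP[xy /eqP->]]].
case: x y xy => [a|e] [b|f] //= ef; first by exists a, f.
by exists b, e; rewrite setUC.
Qed.

Lemma subdivision_coverP S :
  reflect (forall a e, a \in val e -> (old a \in S) || (sub e \in S))
          (vertex_cover S).
Proof.
apply: (iffP forall_inP) => [cov a e ae|cov A].
  have /cov/set0Pn[x] : [set old a; sub e] \in edge_set SH.
    rewrite inE; apply/existsP; exists (old a); apply/existsP.
    by exists (sub e); rewrite eqxx andbT.
  by rewrite !inE => /andP[/orP[] /eqP-> ->]; rewrite ?orbT.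
move=> AH; have [a [e [ae /= AE]]] := subdivision_edge_ends (Sub A AH).
apply/set0Pn; rewrite AE; case/orP: (cov a e ae) => xS.
  by exists (old a); rewrite !inE eqxx.
by exists (sub e); rewrite !inE eqxx orbT.
Qed.

Lemma connected_subdivision : connected_graph H -> connected_graph SH.
Proof.
move=> cH; apply: (@connected_in_transfer H SH _ _ (fun a => old a) cH).
- by move=> x _; rewrite inE.
- move=> x y _ _ /edge_of_adj[e eE].
  apply: (@connect_trans _ _ (sub e)); apply: connect_within; rewrite ?inE //=.
    by rewrite eE !inE eqxx.
  by rewrite eE !inE eqxx orbT.
- case=> [a|e] _; first by exists a; rewrite ?inE.
  have [a ae] : exists a, a \in val e.
    have := valP e; rewrite inE => /existsP[x /existsP[y /andP[_ /eqP->]]].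
    by exists x; rewrite !inE eqxx.
  by exists a; rewrite ?inE //; apply: connect_within; rewrite ?inE.
Qed.

(** * Moving guards in a subdivision *)

(** All subdivision vertices next to the empty vertex [a] are occupied, so [e]
is a leaf of the guarded subgraph and can be given up, and [a] is attached to
the rest through a second edge of [H] at [a]. *)
Lemma sub_guard_slide S a e :
    2 <= min_degree H -> connected_vertex_cover S ->
    old a \notin S -> a \in val e ->
  connected_vertex_cover (old a |: S :\ sub e).
Proof.
move=> degH /andP[/subdivision_coverP cov cS] aS ae.
have subS f : a \in val f -> sub f \in S.
  by move/cov; rewrite (negPf aS).
have eS := subS e ae; have [f nfe af] := other_edge e a degH.
have fS := subS f af; have [b ab eE] := edge_ends ae.
have nba : b != a by apply: contraTneq ab => ->; rewrite adj_irrefl.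
(* Were b empty too, the guard on e would be isolated from the one on f. *)
have bS : old b \in S.
  have [|||u [v [_ uD vS _]]] := @connected_in_crossing _ S [set sub e] _ (sub f) cS eS.
  - by rewrite inE.
  - by [].
  - by rewrite inE.
  move: uD vS; rewrite inE => /eqP->; case: v => //= c cS0.
  by rewrite eE !inE => /orP[] /eqP cE; rewrite cE ?(negPf aS) in cS0 *.
apply/andP; split.
  apply/subdivision_coverP => c g cg; rewrite !inE /=.
  have [ge|nge] := eqVneq g e; last first.
    have -> : (sub g == sub e) = false by apply: contraNF nge => /eqP[->].
    by case/orP: (cov c g cg) => ->; rewrite ?orbT.
  by move: cg; rewrite ge eE !inE => /orP[] /eqP->; rewrite ?eqxx // bS !orbT.
pose r x := if x == sub e then old b else x.
have inT x : x \in S -> x != sub e -> x \in old a |: S :\ sub e.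
  by move=> xS xe; rewrite !inE xS xe orbT.
have reE : r (sub e) = old b by rewrite /r eqxx.
have rE x : x != sub e -> r x = x by rewrite /r => /negPf->.
have nfe' : sub f != sub e by apply: contra nfe => /eqP[->].
have from_e y : y \in S -> adj (sub e) y -> y = old b.
  case: y => //= c cS0; rewrite eE !inE => /orP[] /eqP cE; rewrite cE //.
  by rewrite -cE cS0 in aS.
apply: (connected_in_transfer (r := r) cS).
- move=> x xS; have [->|xe] := eqVneq x (sub e); last by rewrite rE ?inT.
  by rewrite reE inT.
- move=> x y xS yS xy; have [xe|xe] := eqVneq x (sub e).
    by rewrite xe in xy *; rewrite (from_e y yS xy) reE rE.
  have [ye|ye] := eqVneq y (sub e).
    by rewrite ye adj_sym in xy *; rewrite (from_e x xS xy) reE rE.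
  by rewrite !rE //; apply: connect_within xy; apply: inT.
- move=> z; rewrite 2!inE => /orP[/eqP->|/setD1P[ze zS]].
    exists (sub f) => //; rewrite rE //; apply: connect_within => //.
      by rewrite !inE eqxx.
    exact: inT.
  by exists z; rewrite ?rE.
Qed.

(** The guarded vertices contain a simple path from [a] to the other end [b] of
[e].  Its first inner vertex [g] is given up: both neighbours [a] and [v] of
[g] are guarded, and they stay connected by the rest of the path from [v] to
[b] followed by [e]. *)
Lemma old_guard_push S a e :
    connected_vertex_cover S ->
    old a \in S -> sub e \notin S -> a \in val e ->
  exists g, [/\ a \in val g, sub g \in S &
                connected_vertex_cover (sub e |: S :\ sub g)].
Proof.
move=> /andP[/subdivision_coverP cov cS] aS eS ae.
have [b ab eE] := edge_ends ae.
have nba : b != a by apply: contraTneq ab => ->; rewrite adj_irrefl.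
have be : b \in val e by rewrite eE !inE eqxx orbT.
have bS : old b \in S by have := cov b e be; rewrite (negPf eS) orbF.
have /connectP[p0 pth0 last0] := connected_inP cS aS bS.
case/shortenP: pth0 last0 => p pth uniqp _ {p0} last_p.
case: p pth uniqp last_p => [_ _ [ba]|[a'|g] p /=].
- by rewrite ba eqxx in nba.
- by rewrite /within /= !andbF.
case/andP=> /andP[/andP[_ gS] ag] pth /andP[anotin /andP[gnotin uniqp]] last_p.
case: p pth anotin gnotin uniqp last_p => // -[v|//] p /=; last first.
  by rewrite /within /= !andbF.
case/andP=> /andP[/andP[_ vS] vg] pth anotin gnotin uniqp last_p.
exists g; split=> //; set T : {set SH} := _ |: _.
have inT x : x \in S -> x != sub g -> x \in T.
  by move=> xS xg; rewrite !inE xS xg orbT.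
have nva : v != a.
  by apply: contraNneq anotin => ->; rewrite !inE eqxx orbT.
have [c ac gE] := edge_ends ag.
have vc : v = c by move: vg; rewrite /= gE !inE (negPf nva) => /eqP.
have eT : sub e \in T by rewrite !inE eqxx.
have aT : old a \in T by apply: inT.
(* The path is simple, so its part from v on avoids the vacated vertex g. *)
have vb : connect (within T) (old v) (old b).
  apply/connectP; exists p => //.
  have pg : sub g \notin old v :: p by [].
  elim: p (old v) vS {last_p anotin uniqp gnotin} pth pg => //= y p IHp x xS.
  case/andP=> /andP[/andP[_ yS] xy] pth; rewrite !inE !negb_or.
  case/and3P=> gx gy gp.
  have xT : x \in T by apply: (inT x xS); rewrite eq_sym.
  have yT : y \in T by apply: (inT y yS); rewrite eq_sym.
  have -> : within T x y by apply/andP; split; first exact/andP.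
  by apply: (IHp y yS pth); rewrite inE negb_or gy gp.
have va : connect (within T) (old v) (old a).
  apply: (connect_trans vb); apply: (@connect_trans _ _ (sub e)).
    by apply: connect_within => //; apply: inT.
  by apply: connect_within.
have toa y : y \in S -> adj (sub g) y -> connect (within T) y (old a).
  case: y => //= d dS; rewrite gE !inE => /orP[] /eqP->; first exact: connect0.
  by rewrite -vc.
apply/andP; split.
  apply/subdivision_coverP => d h dh; have [hg|nhg] := eqVneq h g.
    apply/orP; left; apply: inT => //.
    by move: dh; rewrite hg gE !inE -vc => /orP[] /eqP->.
  case/orP: (cov d h dh) => xS; apply/orP; [left | right]; apply: inT => //.
pose r x := if x == sub g then old a else x.
have rgE : r (sub g) = old a by rewrite /r eqxx.
have rE x : x != sub g -> r x = x by rewrite /r => /negPf->.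
apply: (connected_in_transfer (r := r) cS).
- by move=> x xS; have [->|xg] := eqVneq x (sub g); rewrite ?rgE // rE ?inT.
- move=> x y xS yS xy; have [xg|xg] := eqVneq x (sub g).
    rewrite xg in xy *; rewrite rgE within_connect_sym.
    by rewrite rE ?toa //; case: (y) xy.
  have [yg|yg] := eqVneq y (sub g).
    by rewrite yg adj_sym in xy *; rewrite rgE rE ?toa.
  by rewrite !rE //; apply: connect_within xy; apply: inT.
- move=> z; rewrite 2!inE => /orP[/eqP->|/setD1P[zg zS]].
    by exists (old a) => //; rewrite rE //; apply: connect_within.
  by exists z; rewrite ?rE.
Qed.

Lemma subdivision_response S (A : edge SH) :
    2 <= min_degree H -> connected_vertex_cover S ->
  exists phi, legal_response S A phi.
Proof.
move=> degH cvcS; have [a [e [ae AE]]] := subdivision_edge_ends A.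
have cov : (old a \in S) || (sub e \in S).
  by case/andP: cvcS => /subdivision_coverP/(_ a e ae).
have swap x : tperm (old a) (sub e) x = x \/ adj x (tperm (old a) (sub e) x).
  by case: tpermP => [->|->|]; [right|right|left].
have [aS|aS] := boolP (old a \in S); last first.
  have eS : sub e \in S by rewrite (negPf aS) in cov.
  exists (tperm (old a) (sub e)); split=> //.
  - by move=> x y _ _; apply: perm_inj.
  - by exists (sub e); rewrite // tpermR AE setUC.
  suff -> : tperm (old a) (sub e) @: S = old a |: S :\ sub e.
    exact: sub_guard_slide.
  apply/setP=> x; rewrite -{1}(tpermK (old a) (sub e) x).
  rewrite mem_imset; last exact: perm_inj.
  case: tpermP => [->|->|/eqP xa /eqP xe]; rewrite !inE ?eqxx ?(negPf aS) ?eS //.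
  by rewrite (negPf xa) xe.
have [eS|eS] := boolP (sub e \in S).
  exists (tperm (old a) (sub e)); split=> //.
  - by move=> x y _ _; apply: perm_inj.
  - by exists (old a); rewrite // tpermL AE.
  suff -> : tperm (old a) (sub e) @: S = S by [].
  apply/setP=> x; rewrite -{1}(tpermK (old a) (sub e) x).
  rewrite mem_imset; last exact: perm_inj.
  by case: tpermP => [->|->|//]; rewrite aS eS.
have [g [ag gS cvcT]] := old_guard_push cvcS aS eS ae.
pose phi (x : SH) : SH := if x == old a then sub e else if x == sub g then old a else x.
have phia : phi (old a) = sub e by rewrite /phi eqxx.
have phig : phi (sub g) = old a by rewrite /phi eqxx.
have phiE (x : SH) : x != old a -> x != sub g -> phi x = x.
  by rewrite /phi => /negPf-> /negPf->.
have phiP (x : SH) : x \in S -> [\/ x = old a, x = sub g |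
    [/\ phi x = x, x != old a, x != sub g & x != sub e]].
  move=> xS; have [->|xa] := eqVneq x (old a); first by constructor 1.
  have [->|xg] := eqVneq x (sub g); first by constructor 2.
  constructor 3; split; [exact: phiE | by [] | by [] |].
  by apply/eqP => xe; rewrite -xe xS in eS.
exists phi; split.
- by move=> x /phiP[->|->|[-> _ _ _]]; rewrite ?phia ?phig; [right|right|left].
- move=> x y /phiP[->|->|[-> xa xg xe]] /phiP[->|->|[-> ya yg ye]] //;
    rewrite ?phia ?phig //.
  + by move=> eqy; rewrite eqy eqxx in ye.
  + by move=> eqy; rewrite eqy eqxx in ya.
  + by move=> eqx; rewrite eqx eqxx in xe.
  + by move=> eqx; rewrite eqx eqxx in xa.
- by exists (old a); rewrite // phia AE.
suff -> : phi @: S = sub e |: S :\ sub g by [].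
apply/setP=> x; apply/imsetP/idP => [[y yS ->]|].
  case/phiP: (yS) => [->|->|[-> _ yg _]].
  - by rewrite phia !inE eqxx.
  - by rewrite phig !inE aS.
  - by rewrite !inE yg yS orbT.
rewrite 2!inE => /orP[/eqP->|/setD1P[xg xS]]; first by exists (old a).
have [->|xa] := eqVneq x (old a); first by exists (sub g).
by exists x; rewrite ?phiE.
Qed.

(** * Size of a minimum connected vertex cover *)

(** Each slide onto an empty old vertex keeps the number of guards and leaves
one empty old vertex fewer. *)
Lemma cover_with_old_vertices S :
    2 <= min_degree H -> connected_vertex_cover S ->
  exists T, [/\ connected_vertex_cover T, #|T| = #|S| & forall a, old a \in T].
Proof.
move=> degH; have [k] := ubnP #|[set a | old a \notin S]|.
elim: k S => // k IHk S ltk cvcS.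
have [[a aS]|all_old] := pselect (exists a, old a \notin S); last first.
  by exists S; split=> // a; apply: contrapT => /negP aS; case: all_old; exists a.
have [e ae] : exists e, a \in val e.
  have : 0 < degree a.
    by apply: leq_trans (ltnW degH) _; apply: bigminn_le.
  case/card_gt0P=> b; rewrite inE => /edge_of_adj[e eE].
  by exists e; rewrite eE !inE eqxx.
have eS : sub e \in S.
  by case/andP: cvcS => /subdivision_coverP/(_ a e ae); rewrite (negPf aS).
have cvcT := sub_guard_slide degH cvcS aS ae.
have cardT : #|old a |: S :\ sub e| = #|S|.
  by rewrite cardsU1 !inE (negPf aS) (cardsD1 (sub e) S) eS.
have [|T [? cardT' ?]] := IHk _ _ cvcT; last by exists T; rewrite cardT' cardT.
rewrite -ltnS; apply: leq_trans ltk; rewrite ltnS; apply: proper_card.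
apply/properP; split; last by exists a; rewrite !inE ?eqxx ?aS.
by apply/subsetP=> b; rewrite !inE negb_or /= => /andP[].
Qed.

(** A spanning tree is obtained as a largest subtree.  A subtree is
encoded by its vertices in the subdivision: it is connected, contains the ends
of its edges, and has one edge fewer than old vertices. *)
Lemma subdivision_spanning_tree S :
    connected_in S -> (forall a, old a \in S) -> 0 < #|H| ->
  exists C, [/\ C \subset S, connected_vertex_cover C & #|C| = 2 * #|H| - 1].
Proof.
move=> cS oldS /card_gt0P[a0 _].
pose trace (C : {set SH}) := [set a | old a \in C].
pose treelike (C : {set SH}) := [&& C \subset S, connected_in C,
  [forall e : edge H, forall a in val e, (sub e \in C) ==> (old a \in C)]
  & #|C|.+1 == 2 * #|trace C|].
have tree0 : treelike [set old a0].
  apply/and4P; split.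
  - by rewrite sub1set.
  - apply/andP; split; first by apply/set0Pn; exists (old a0); rewrite inE.
    apply/forall_inP => x; rewrite inE => /eqP->.
    by apply/forall_inP => y; rewrite inE => /eqP->; apply: connect0.
  - by apply/forallP => e; apply/forall_inP => a _; rewrite !inE.
  - suff -> : trace [set old a0] = [set a0] by rewrite !cards1.
    by apply/setP=> a; rewrite !inE.
case: (arg_maxnP (fun C => #|C|) tree0) => C /and4P[CS cC closed cardC] maxC.
have [[b bC]|all_old] := pselect (exists b, old b \notin C); last first.
  have oldC a : old a \in C.
    by apply: contrapT => /negP aC; case: all_old; exists a.
  exists C; split=> //.
    by apply/andP; split=> //; apply/subdivision_coverP => a e _; rewrite oldC.
  move/eqP: cardC; suff -> : trace C = [set: H] by rewrite cardsT => <-; rewrite subn1.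
  by apply/setP=> a; rewrite !inE oldC.
have closedC e a : a \in val e -> sub e \in C -> old a \in C.
  by move=> ae; move/forallP/(_ e)/forall_inP/(_ a ae)/implyP: closed; apply.
have /set0Pn[x xC] : C != set0 by case/andP: cC.
(* D is C with the neighbours of its old vertices: leaving C itself might only
lead to an edge between two old vertices of C, whereas leaving D reaches a new
old vertex. *)
pose D := C :|: [set y | [exists a, (old a \in C) && adj (old a) y]].
have [|||u [v [uS uD vS vD uv]]] :=
    @connected_in_crossing _ S D x (old b) cS (subsetP CS x xC).
- by rewrite inE xC.
- exact: oldS.
- by rewrite !inE (negPf bC) /=; apply/existsP => -[a /andP[]].
have {vD} [vC vD] : v \notin C /\ ~ exists2 a, old a \in C & adj (old a) v.
  move: vD; rewrite !inE negb_or => /andP[vC vD]; split=> // -[a aC av].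
  by case/existsP: vD; exists a; rewrite aC.
case: u uS uD uv => [a|e] uS uD uv.
  case: vD; exists a => //; move: uD; rewrite !inE => /orP[//|].
  by case/existsP => a' /andP[].
case: v vS vC vD uv => // c cinS cC0 _ ce.
have eC : sub e \notin C by apply: contra cC0; apply: closedC.
have [a aC ae] : exists2 a, old a \in C & a \in val e.
  by move: uD; rewrite !inE (negPf eC) => /existsP[a /andP[aC ae]]; exists a.
have eE d : d \in val e -> d = a \/ d = c.
  have [c' _ eE] := edge_ends ae; rewrite eE !inE => /orP[] /eqP->; first by left.
  move: ce; rewrite /= eE !inE => /orP[] /eqP cE; last by right.
  by rewrite cE aC in cC0.
pose T := old c |: (sub e |: C).
have CT y : y \in C -> y \in T by move=> yC; rewrite !inE yC !orbT.
have cardT : #|T| = #|C|.+2 by rewrite !cardsU1 !inE (negPf cC0) (negPf eC).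
suff /maxC : treelike T by rewrite /= cardT ltnNge leqnSn.
have eT : sub e \in T by rewrite !inE eqxx orbT.
have cT : old c \in T by rewrite !inE eqxx.
apply/and4P; split.
- by rewrite !subUset !sub1set cinS uS.
- apply: (connected_in_transfer (r := id) cC); first exact: CT.
    by move=> y z /CT yT /CT zT; apply: connect_within.
  have ea : connect (within T) (sub e) (old a).
    by apply: connect_within => //; apply: CT.
  move=> z; rewrite !inE => /or3P[/eqP->|/eqP->|zC]; last by exists z.
    by exists (old a) => //; apply: connect_trans ea; apply: connect_within.
  by exists (old a).
- apply/forallP => f; apply/forall_inP => d df; apply/implyP.
  rewrite inE => /orP[/set1P//|]; rewrite inE => /orP[/set1P[fe]|fC].
    by rewrite fe in df; case: (eE d df) => ->; first exact: CT.
  by apply: CT; apply: closedC fC.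
- have -> : trace T = c |: trace C by apply/setP=> d; rewrite !inE.
  by rewrite cardT cardsU1 inE (negPf cC0) mulnDr -(eqP cardC).
Qed.

End Subdivision.

Theorem theorem3 (H : sgraph) (n0 m0 : nat)
    (connH : connected_graph H)
    (vertH : #|H| = n0) (edgeH : #|edge_set H| = m0)
    (degH : 2 <= min_degree H) :
  (ecvc (subdivision H) = cvc (subdivision H) /\
   cvc (subdivision H) = 2 * n0 - 1) /\
  (forall S : {set subdivision H},
     min_connected_vertex_cover S -> eternally_winning S).
Proof.
have connSH := connected_subdivision connH.
have wins (S : {set subdivision H}) :
    connected_vertex_cover S -> eternally_winning S.
  apply: eternally_winning_of_responses => {}S A.
  exact: subdivision_response degH.
have [S cvcS cardS] := cvc_min connSH.
split; last by move=> T [cvcT _]; apply: wins.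
split.
  apply/eqP; rewrite eqn_leq; apply/andP; split.
    by apply: ecvc_le; exists S; split=> //; apply: wins.
  by have [T [<- [cvcT _]]] := ecvc_min connSH; apply: cvc_le.
have H_gt0 : 0 < #|H| by case/andP: connH; rewrite -card_gt0 cardsT.
have [T [/andP[_ cT] cardT oldT]] := cover_with_old_vertices degH cvcS.
have [C [CT cvcC cardC]] := subdivision_spanning_tree cT oldT H_gt0.
rewrite -vertH -cardC; apply/eqP; rewrite eqn_leq cvc_le //=.
by rewrite -cardS -cardT subset_leq_card.
Qed.
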